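(* Let $G$ be a metric graph, let $p\ge1$ be an integer and $m=p-1$. For all $x_1,x_2\in G$, $$\gamma_p(x_1,x_2)=\max\big\{(f(x_1)-f(x_2))^2\ :\ f\in\mathcal F,\ \|f\|_{\mathcal F}=1\big\},$$ and, for $x_1\ne x_2$, $$\gamma_p(x_1,x_2)=\Big(\min\big\{\|f\|_{\mathcal F}^2\ :\ f\in\mathcal F,\ |f(x_1)-f(x_2)|=1\big\}\Big)^{-1}.$$ In addition, the covariance function of $Z_m$ satisfies, for all $x_1,x_2\in G$, $$C_{Z_m}(x_1,x_2)=c+\frac1{2n}\sum_{v\in V}\big(\gamma_p(v,x_1)+\gamma_p(v,x_2)-\gamma_p(x_1,x_2)\big),$$ where $c=-\frac1{2n^2}\sum_{v,w\in V}\gamma_p(v,w)$ does not depend on $x_1,x_2$.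
   Context: A metric graph $G=(V,E)$ has a finite vertex set $V$ ($n:=|V|$) and a finite edge set $E$; each edge $e\in E$ has a length $0<l_e<\infty$ and is identified with the segment $[0,l_e]$, edges being glued at their common endpoints (the vertices). $G$ also denotes the set of all points on the edges (vertices included). Throughout, $G$ is connected and simple (no self-loops, no multiple edges). For $f:G\to\mathbb R$, $f_e$ is the restriction of $f$ to $e$ viewed as a function on $[0,l_e]$, and $\int_G f(x)\,dx:=\sum_{e\in E}\int_0^{l_e}f_e(x)\,dx$. For $v\in V$, $E_v$ is the set of edges incident to $v$. The exiting directional derivative is $\partial_e f(v):=\lim_{h\to0^+}\frac{f(v+he)-f(v)}{h}$, where $v+he$ is the point of $e$ at shortest-path distance $h$ from $v$; $\partial_e^i$ is the $i$-th order exiting derivative. $f\in C^m(G)$ means: $f|_e\in C^m(e)$ for each $e\in E$, and at each $v\in V$ the Kirchhoff conditions of every order $i\in\{0,\dots,m\}$ hold: if $i$ is even, all exiting derivatives $\partial_e^i f(v)$, $e\in E_v$, are equal; if $i$ is odd, $\sum_{e\in E_v}\partial_e^i f(v)=0$. For an integer $p\ge1$ let $m:=p-1$. Let $\mathcal F$ be the set of $f:G\to\mathbb R$ such that $f\in C^m(G)$; for each $e\in E$, $f_e^{(m)}$ is absolutely continuous and $f_e^{(m+1)}\in L^2([0,l_e])$; and $\sum_{v\in V}f(v)=0$. Put $\langle f,g\rangle_{\mathcal F}:=\int_G f^{(p)}(x)g^{(p)}(x)\,dx$, with induced norm $\|\cdot\|_{\mathcal F}$. Then $\mathcal H=(\mathcal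 F,\langle\cdot,\cdot\rangle_{\mathcal F})$ is a reproducing kernel Hilbert space (RKHS). $Z=Z_m$ is the (unique in law) zero-mean Gaussian process on $G$ whose RKHS is $\mathcal H$ (i.e. its covariance function $C_{Z_m}$ is the reproducing kernel of $\mathcal H$), and $\gamma_p(x_1,x_2):=\mathrm{Var}(Z(x_1)-Z(x_2))$ is its variogram. *)

(* Defs.v *)
From HB Require Import structures.
From mathcomp Require Import all_boot all_order all_algebra.
From mathcomp Require Import all_classical all_reals all_analysis.

Set Implicit Arguments.
Unset Strict Implicit.
Unset Printing Implicit Defensive.

Import Order.TTheory GRing.Theory Num.Theory.
Import numFieldNormedType.Exports.

Local Open Scope classical_set_scope.
Local Open Scope ring_scope.

Definition is_max (R : realType) (A : set R) (a : R) : Prop :=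
  A a /\ ubound A a.

Definition is_min (R : realType) (A : set R) (a : R) : Prop :=
  A a /\ lbound A a.

(* The library's [derive1] is two-sided, hence sees values outside a closed
   interval; the difference quotients below only use points of [A], so that the
   derivative at an end point of an interval is the one-sided one. *)
Definition derivable_on (R : realType) (A : set R) (f : R -> R) (x : R) : Prop :=
  cvg ((f y - f x) / (y - x) @[y --> within A x^']).

Definition derive_on (R : realType) (A : set R) (f : R -> R) : R -> R :=
  fun x => lim ((f y - f x) / (y - x) @[y --> within A x^']).

Definition deriven_on (R : realType) (A : set R) (n : nat) (f : R -> R) : R -> R :=
  iter n (derive_on A) f.

Definition continuously_derivable_on (R : realType) (A : set R) (m : nat)
    (f : R -> R) : Prop :=
  (forall i x, (i < m)%N -> A x -> derivable_on A (deriven_on A i f) x) /\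
  {within A, continuous (deriven_on A m f)}.

Definition absolutely_continuous_on (R : realType) (a b : R) (f : R -> R) : Prop :=
  forall eps : R, 0 < eps -> exists2 delta : R, 0 < delta &
    forall (k : nat) (u v : 'I_k -> R),
      (forall i, [/\ a <= u i, u i <= v i & v i <= b]) ->
      trivIset [set: 'I_k] (fun i => `]u i, v i[%classic) ->
      \sum_(i < k) (v i - u i) < delta ->
      \sum_(i < k) `|f (v i) - f (u i)| < eps.

(* [src e] and [tgt e] are the end points glued to the parameters [0] and
   [len e] of the segment identified with [e]; this orientation is the choice
   implicit in that identification. *)
Record metric_graph (R : realType) := MetricGraph {
  vertex : finType;
  edge : finType;
  src : edge -> vertex;
  tgt : edge -> vertex;
  len : edge -> R;
  len_gt0 : forall e, 0 < len e;
  no_loop : forall e, src e != tgt e;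
  no_multi : injective (fun e => [set src e; tgt e]%SET);
  graph_connected : forall u v : vertex,
    connect (fun a b => [exists e, [set src e; tgt e]%SET == [set a; b]%SET]) u v
}.

(* The glued space: each point is either a vertex or an interior point of
   exactly one edge. *)
Inductive gpoint (R : realType) (G : metric_graph R) : Type :=
| Vertex of vertex G
| Inner (e : edge G) (x : R) of 0 < x < len e.

Arguments Vertex {R G} _.
Arguments Inner {R G} e x _.

(* The point with parameter [x] in [0, len e] on [e]; parameters outside this
   segment are clamped to it and never matter. *)
Definition edge_point (R : realType) (G : metric_graph R) (e : edge G) (x : R) :
    gpoint G :=
  match @idP (0 < x < len e) with
  | ReflectT h => Inner e x h
  | ReflectF _ => Vertex (if x <= 0 then src e else tgt e)
  end.

Definition incident (R : realType) (G : metric_graph R) (v : vertex G) :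
    {set edge G} :=
  [set e | (v == src e) || (v == tgt e)]%SET.

(* The point [v + h e], for [e] incident to [v]. *)
Definition exit_point (R : realType) (G : metric_graph R) (v : vertex G)
    (e : edge G) (h : R) : gpoint G :=
  edge_point e (if v == src e then h else len e - h).

Definition edge_set (R : realType) (G : metric_graph R) (e : edge G) : set R :=
  `[0, len e]%classic.

Definition edge_fun (R : realType) (G : metric_graph R) (f : gpoint G -> R)
    (e : edge G) : R -> R :=
  fun x => f (edge_point e x).

Definition edge_deriven (R : realType) (G : metric_graph R) (i : nat)
    (f : gpoint G -> R) (e : edge G) : R -> R :=
  deriven_on (edge_set e) i (edge_fun f e).

Definition exit_deriven (R : realType) (G : metric_graph R) (i : nat)
    (f : gpoint G -> R) (v : vertex G) (e : edge G) : R :=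
  deriven_on (edge_set e) i (fun h => f (exit_point v e h)) 0.

Definition kirchhoff (R : realType) (G : metric_graph R) (i : nat)
    (f : gpoint G -> R) (v : vertex G) : Prop :=
  if odd i then \sum_(e in incident v) exit_deriven i f v e = 0
  else {in incident v &, forall e e',
          exit_deriven i f v e = exit_deriven i f v e'}.

Definition Cm (R : realType) (G : metric_graph R) (m : nat)
    (f : gpoint G -> R) : Prop :=
  (forall e : edge G, continuously_derivable_on (edge_set e) m (edge_fun f e)) /\
  (forall (v : vertex G) (i : nat), (i <= m)%N -> kirchhoff i f v).

(* Elements of [L^2] are defined almost everywhere only. The almost everywhere
   existence of [f_e^(p)] follows from absolute continuity; it is recorded
   because [derive_on] is a total function with a default value where the limit
   does not exist. *)
Definition FF (R : realType) (G : metric_graph R) (p : nat) :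
    set (gpoint G -> R) :=
  [set f | [/\ Cm p.-1 f,
    forall e : edge G,
      absolutely_continuous_on 0 (len e) (edge_deriven p.-1 f e),
    forall e : edge G,
      {ae @lebesgue_measure R, forall x, edge_set e x ->
        derivable_on (edge_set e) (edge_deriven p.-1 f e) x} /\
      edge_deriven p f e \_ (edge_set e) \in Lfun (@lebesgue_measure R) 2%:E
    & \sum_(v : vertex G) f (Vertex v) = 0]].

Definition innerF (R : realType) (G : metric_graph R) (p : nat)
    (f g : gpoint G -> R) : R :=
  \sum_(e : edge G) \int[@lebesgue_measure R]_(x in edge_set e)
    (edge_deriven p f e x * edge_deriven p g e x).

Definition normF (R : realType) (G : metric_graph R) (p : nat)
    (f : gpoint G -> R) : R :=
  Num.sqrt (innerF p f f).

Definition reproducing_kernel (R : realType) (T : Type) (F : set (T -> R))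
    (inner : (T -> R) -> (T -> R) -> R) (K : T -> T -> R) : Prop :=
  (forall x, F (K^~ x)) /\
  (forall f x, F f -> f x = inner f (K^~ x)).

(* The library's [normal_prob m 0] is not the Dirac mass at [m]. *)
Definition gaussian_variable (R : realType) (d : measure_display)
    (Omega : measurableType d) (P : probability Omega R) (X : Omega -> R) : Prop :=
  exists m s : R, forall A : set R, measurable A ->
    P (X @^-1` A) = if s == 0 then \d_m A else normal_prob m s A.

Definition gaussian_process (R : realType) (d : measure_display)
    (Omega : measurableType d) (P : probability Omega R) (T : Type)
    (Z : T -> {RV P >-> R}) : Prop :=
  forall (k : nat) (c : 'I_k -> R) (x : 'I_k -> T),
    gaussian_variable P (fun w => \sum_(i < k) c i * Z (x i) w).

Definition centered (R : realType) (d : measure_display)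
    (Omega : measurableType d) (P : probability Omega R) (T : Type)
    (Z : T -> {RV P >-> R}) : Prop :=
  forall x, ('E_P[Z x] = 0)%E.

Definition covfun (R : realType) (d : measure_display)
    (Omega : measurableType d) (P : probability Omega R) (T : Type)
    (Z : T -> {RV P >-> R}) (x y : T) : R :=
  fine (covariance P (Z x) (Z y)).

Definition variogram (R : realType) (d : measure_display)
    (Omega : measurableType d) (P : probability Omega R) (T : Type)
    (Z : T -> {RV P >-> R}) (x y : T) : R :=
  fine 'V_P[Z x \- Z y].

Definition has_rkhs (R : realType) (d : measure_display)
    (Omega : measurableType d) (P : probability Omega R) (T : Type)
    (Z : T -> {RV P >-> R}) (F : set (T -> R))
    (inner : (T -> R) -> (T -> R) -> R) : Prop :=
  (forall x y, covariance P (Z x) (Z y) \is a fin_num) /\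
  reproducing_kernel F inner (covfun Z).

(* Main.v *)
Require Import Defs.
From mathcomp Require Import all_boot all_order all_algebra.
From mathcomp Require Import all_classical all_reals all_analysis.
From mathcomp Require Import measurable_realfun ring lra.

Set Implicit Arguments.
Unset Strict Implicit.
Unset Printing Implicit Defensive.

Import Order.TTheory GRing.Theory Num.Theory.
Import numFieldNormedType.Exports.

Local Open Scope classical_set_scope.
Local Open Scope ring_scope.

(* With K the covariance, hence the reproducing kernel, the function
   k = K(., x1) - K(., x2) lies in the space and represents the increment
   f |-> f x1 - f x2, and its squared norm is gamma x1 x2; so both extremal
   formulas are Cauchy-Schwarz, the extremal functions being multiples of k.
   The formula for K follows from gamma x y = K x x + K y y - 2 K x y because
   the sum over the vertices v of K(v, x) vanishes.  What has to be checked on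
   the graph is that the space is a vector space on which the inner product is
   bilinear, and that it separates points. *)

(** * Derivatives relative to a segment: linearity and reflection *)

Section derive_on_segment.
Context (R : realType).
Implicit Types (l x a b : R) (f g : R -> R).

(** A small step toward the farther end stays in the segment. Properness makes limits unique, so a
    value of [derive_on] is found by exhibiting a limit. *)
Lemma segment_dnbhs_proper l x : 0 < l -> x \in `[0, l] ->
  ProperFilter (within `[0, l]%classic x^').
Proof.
rewrite in_itv/= => l0 /andP[x0 xl]; apply: Build_ProperFilter_ex => P.
rewrite /within /= /dnbhs /within /= => /nbhs_ballP[e /= e0 eP].
pose h := Num.min (e / 2) (l / 2).
have h0 : 0 < h by rewrite lt_min !divr_gt0.
have he : h < e by rewrite gt_min ltr_pdivrMr// ltr_pMr// ltr1n.
have hl : h <= l / 2 by rewrite ge_min lexx orbT.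
have [xl2|xl2] := leP x (l / 2).
- exists (x + h); apply: eP; first
    by rewrite /ball/= opprD addrA subrr sub0r normrN gtr0_norm.
    by rewrite -subr_eq0 addrAC subrr add0r gt_eqF.
  rewrite /= in_itv/=; lra.
- exists (x - h); apply: eP; first
    by rewrite /ball/= opprB addrC subrK gtr0_norm.
    by rewrite -subr_eq0 addrAC subrr add0r oppr_eq0 gt_eqF.
  rewrite /= in_itv/=; lra.
Qed.

Lemma within_dnbhs_in (A : set R) x : \forall y \near within A x^', A y.
Proof. by rewrite near_withinE; near=> y. Unshelve. all: by end_near. Qed.

Lemma within_dnbhs_neq (A : set R) x : \forall y \near within A x^', y != x.
Proof.
rewrite near_withinE /dnbhs near_withinE; near=> y; by [].
Unshelve. all: by end_near. Qed.

Lemma derive_on_cvg l f x : derivable_on `[0, l]%classic f x ->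
  (f y - f x) / (y - x) @[y --> within `[0, l] x^']
    --> derive_on `[0, l]%classic f x.
Proof. by []. Qed.

Lemma cvg_derive_on l f x a : 0 < l -> x \in `[0, l] ->
  (f y - f x) / (y - x) @[y --> within `[0, l] x^'] --> a ->
  derivable_on `[0, l]%classic f x /\ derive_on `[0, l]%classic f x = a.
Proof.
move=> l0 xl fa; have PF := segment_dnbhs_proper l0 xl.
by split; [apply/cvg_ex; exists a|exact: cvg_lim].
Qed.

(** The filter is concentrated on [A] and [x] lies in [A], so values outside [A] never enter. *)
Lemma eq_quotient_on (A : set R) f g x : A x -> {in A, f =1 g} ->
  (f y - f x) / (y - x) @[y --> within A x^'] =
  (g y - g x) / (y - x) @[y --> within A x^'].
Proof.
move=> Ax fg; have E : \forall y \near within A x^',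
    (f y - f x) / (y - x) = (g y - g x) / (y - x).
  by apply: filterS (within_dnbhs_in A x) => y Ay; rewrite !fg ?inE.
apply/funext => P; apply/propext; split; apply: filterS2 E => y /=.
  by move=> ->.
by move=> <-.
Qed.

Lemma eq_derivable_on (A : set R) f g x : A x -> {in A, f =1 g} ->
  derivable_on A f x <-> derivable_on A g x.
Proof. by move=> Ax fg; rewrite /derivable_on (eq_quotient_on Ax fg). Qed.

Lemma eq_derive_on (A : set R) f g : {in A, f =1 g} ->
  {in A, derive_on A f =1 derive_on A g}.
Proof.
by move=> fg x /[!inE] Ax; rewrite /derive_on (eq_quotient_on Ax fg).
Qed.

Lemma derive_on_linear l f g a b x : 0 < l -> x \in `[0, l] ->
  derivable_on `[0, l]%classic f x -> derivable_on `[0, l]%classic g x ->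
  derivable_on `[0, l]%classic (fun y => a * f y + b * g y) x /\
  derive_on `[0, l]%classic (fun y => a * f y + b * g y) x =
    a * derive_on `[0, l]%classic f x + b * derive_on `[0, l]%classic g x.
Proof.
move=> l0 xl df dg; apply: cvg_derive_on => //.
rewrite [X in X @ _](_ : _ = fun y => a * ((f y - f x) / (y - x)) +
    b * ((g y - g x) / (y - x))); last by apply/funext => y /=; ring.
by apply: cvgD; apply: cvgM => //; exact: cvg_cst.
Qed.

(** The part of [continuously_derivable_on] that concerns existence, isolated because linearity of
    the iterated derivatives rests on it alone. *)
Definition nderivable_on (A : set R) m f :=
  forall i x, (i < m)%N -> A x -> derivable_on A (deriven_on A i f) x.

Lemma deriven_on_linear l m f g a b : 0 < l ->
  nderivable_on `[0, l] m f -> nderivable_on `[0, l] m g ->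
  forall i, (i <= m)%N -> {in `[0, l]%classic,
    deriven_on `[0, l]%classic i (fun y => a * f y + b * g y) =1
    (fun y => a * deriven_on `[0, l]%classic i f y +
              b * deriven_on `[0, l]%classic i g y)}.
Proof.
move=> l0 df dg; elim=> [//|i IH im x xl].
have := eq_derive_on (IH (ltnW im)) xl => /= ->.
move: xl; rewrite inE => xl.
by have [_ ->] := derive_on_linear a b l0 xl (df _ _ im xl) (dg _ _ im xl).
Qed.

Lemma nderivable_on_linear l m f g a b : 0 < l ->
  nderivable_on `[0, l] m f -> nderivable_on `[0, l] m g ->
  nderivable_on `[0, l] m (fun y => a * f y + b * g y).
Proof.
move=> l0 df dg i x im xl.
apply/(eq_derivable_on _ (deriven_on_linear a b l0 df dg (ltnW im))) => //.
by have [] := derive_on_linear a b l0 xl (df _ _ im xl) (dg _ _ im xl).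
Qed.

Lemma continuously_derivable_on_linear l m f g a b : 0 < l ->
  continuously_derivable_on `[0, l]%classic m f ->
  continuously_derivable_on `[0, l]%classic m g ->
  continuously_derivable_on `[0, l]%classic m (fun y => a * f y + b * g y).
Proof.
move=> l0 [df cf] [dg cg]; split; first exact: nderivable_on_linear.
apply: (@subspace_eq_continuous _ `[0, l]%classic _
  (fun y => a * deriven_on `[0, l]%classic m f y +
            b * deriven_on `[0, l]%classic m g y)).
  by move=> x xl; exact/esym/(deriven_on_linear a b l0 df dg).
by move=> x; apply: cvgD; apply: cvgM;
  [exact: cvg_cst|exact: cf|exact: cvg_cst|exact: cg].
Qed.

Lemma cvg_segment_rev l x :
  l - y @[y --> within `[0, l]%classic x^'] --> within `[0, l]%classic (l - x)^'.
Proof.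
move=> P; rewrite /within /= /dnbhs /within /= => /nbhs_ballP[e /= e0 eP].
apply/nbhs_ballP; exists e => //= y xy yx; rewrite in_itv/= => yl; apply: eP.
- by rewrite /ball/= opprB addrC addrA addrNK distrC.
- by apply: contra yx => /eqP/addrI/oppr_inj ->.
- rewrite /= in_itv/=; lra.
Qed.

(** An edge left from its target is parametrized backwards; this is the chain rule for that
    reflection. *)
Lemma derive_on_rev l f x : 0 < l -> x \in `[0, l] ->
  derivable_on `[0, l]%classic f (l - x) ->
  derivable_on `[0, l]%classic (fun y => f (l - y)) x /\
  derive_on `[0, l]%classic (fun y => f (l - y)) x =
    - derive_on `[0, l]%classic f (l - x).
Proof.
move=> l0 xl /derive_on_cvg df; apply: cvg_derive_on => //.
have /cvgN := cvg_comp _ _ (@cvg_segment_rev l x) df.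
apply: cvg_trans; apply: near_eq_cvg; near=> y; rewrite /=.
have -> : y - x = - (l - y - (l - x)) by ring.
by rewrite invrN mulrN.
Unshelve. all: by end_near. Qed.

Lemma nderivable_on_rev l m f : 0 < l -> nderivable_on `[0, l] m f ->
  nderivable_on `[0, l] m (fun y => f (l - y)).
Proof.
move=> l0 df.
have rev_in x : x \in `[0, l] -> l - x \in `[0, l] by rewrite !in_itv/=; lra.
(* Each derivative of the reflected function contributes a factor [-1]. The term with coefficient
   [0] only gives the form that [derive_on_linear] expects. *)
have E i : (i <= m)%N -> {in `[0, l]%classic,
    deriven_on `[0, l]%classic i (fun y => f (l - y)) =1
    (fun y => (-1) ^+ i * deriven_on `[0, l]%classic i f (l - y) +
              0 * deriven_on `[0, l]%classic i f (l - y))}.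
  elim: i => [_ x _|i IH im x xl]; first by rewrite mul1r mul0r addr0.
  have := eq_derive_on (IH (ltnW im)) xl => /= ->; move: xl; rewrite inE => xl.
  have dr := derive_on_rev l0 xl (df _ _ im (rev_in _ xl)).
  have [_ ->] := derive_on_linear ((-1) ^+ i) 0 l0 xl dr.1 dr.1.
  by rewrite dr.2 exprS !mul0r !addr0 mulrN mulN1r mulNr.
move=> i x im xl; apply/(eq_derivable_on _ (E _ (ltnW im))) => //.
have [dr _] := derive_on_rev l0 xl (df _ _ im (rev_in _ xl)).
by have [] := derive_on_linear ((-1) ^+ i) 0 l0 xl dr dr.
Qed.

End derive_on_segment.

(** * Borel measurability of the derivative of a continuous function *)

Section measurable_derive_on.
Context (R : realType).
Implicit Types (l x : R) (f : R -> R).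

Let quot f x y : R := (f y - f x) / (y - x).

Lemma cvg_quotient_on l f x y : {within `[0, l], continuous f} ->
  x \in `[0, l] -> y != x ->
  quot f x' y @[x' --> within `[0, l]%classic (nbhs x)] --> quot f x y.
Proof.
move=> /subspace_continuousP cf xl yx.
have cid : z @[z --> within `[0, l]%classic (nbhs x)] --> x by exact: cvg_within.
apply: cvgM; first by apply: cvgB; [exact: cvg_cst|exact: cf].
apply: cvgV; first by rewrite subr_eq0.
by apply: cvgB => //; exact: cvg_cst.
Qed.

(* Lebesgue measure lives on the Borel sets, which are not complete, and
   [derive_on] takes a junk value where the limit does not exist; so a.e.
   information does not make a derivative measurable.  The set of points where
   the difference quotient oscillates by more than [e] on the scale [dlt] is
   relatively open, hence the set of differentiability is Borel. *)
Definition quotient_osc l f e dlt : set R :=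
  [set x | exists y z, [/\ y \in `[0, l] /\ z \in `[0, l],
    y != x /\ z != x, `|y - x| < dlt /\ `|z - x| < dlt
    & e < `|quot f x y - quot f x z|]].

(** Witnesses [y], [z] for [x] also serve every nearby base point [u] of the segment: for fixed [y]
    and [z] all the conditions on [u] are open, the quotients being continuous in the base point. *)
Lemma measurable_quotient_osc l f e dlt : {within `[0, l], continuous f} ->
  measurable (`[0, l] `&` quotient_osc l f e dlt).
Proof.
move=> cf; apply: open_measurable_subspace => //.
suff H x : quotient_osc l f e dlt x -> x \in `[0, l] ->
    within `[0, l]%classic (nbhs x) (quotient_osc l f e dlt `&` `[0, l]%classic).
  rewrite -open_subspaceIT openE => x [xq xl].
  by rewrite /interior; have := H x xq xl; rewrite nbhs_subspace_in.
move=> [y [z [[yl zl] [yx zx] [yd zd] eyz]]] xl.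
have cid : u @[u --> within `[0, l]%classic (nbhs x)] --> x by exact: cvg_within.
have cn w : `|w - u| @[u --> within `[0, l]%classic (nbhs x)] --> `|w - x|.
  by apply: cvg_norm; apply: cvgB => //; exact: cvg_cst.
have cq : `|quot f u y - quot f u z| @[u --> within `[0, l]%classic (nbhs x)]
    --> `|quot f x y - quot f x z|.
  by apply: cvg_norm; apply: cvgB; exact: cvg_quotient_on.
have ne w : w != x -> \forall u \near within `[0, l]%classic (nbhs x), w != u.
  rewrite -subr_eq0 -normr_gt0 => /(cvgr_gt _ (cn w)).
  by apply: filterS => u; rewrite normr_gt0 subr_eq0.
near=> u; split; last by near: u; rewrite near_withinE; near=> u.
exists y, z; split=> //.
- by split; near: u; exact: ne.
- by split; near: u; exact: (cvgr_lt _ (cn _)).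
- by near: u; exact: (cvgr_gt _ cq).
Unshelve. all: by end_near. Qed.

(** The Cauchy criterion for the difference quotient, with tolerances and scales restricted to
    inverses of integers so that only countable set operations occur. *)
Lemma derivable_onE l f x : 0 < l -> x \in `[0, l] ->
  derivable_on `[0, l]%classic f x <->
  forall k, exists n, ~ quotient_osc l f k.+1%:R^-1 n.+1%:R^-1 x.
Proof.
move=> l0 xl; have PF := segment_dnbhs_proper l0 xl; split.
  move=> /derive_on_cvg /cvgrPdist_lt df k.
  have /df : 0 < (k.+1%:R^-1 / 2 : R) by rewrite divr_gt0// invr_gt0 ltr0n.
  rewrite /within /= /dnbhs /within /= => /nbhs_ballP[e /= e0 eP].
  have [n ne] : exists n, n.+1%:R^-1 < e.
    by have [n] := ltr_add_invr e0; rewrite add0r; exists n.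
  exists n => -[y [z [[yl zl] [yx zx] [yd zd]]]].
  apply/negP; rewrite -leNgt.
  have q w : w \in `[0, l] -> w != x -> `|w - x| < n.+1%:R^-1 ->
      `|derive_on `[0, l]%classic f x - quot f x w| < k.+1%:R^-1 / 2.
    move=> wl wx wd; apply: eP => //.
    by rewrite /ball/= distrC (lt_trans wd).
  have -> : quot f x y - quot f x z =
      (derive_on `[0, l]%classic f x - quot f x z) -
      (derive_on `[0, l]%classic f x - quot f x y) by ring.
  rewrite (le_trans (ler_normB _ _))// [leRHS]splitr ltW// ltrD// q//.
move=> H; apply/cauchy_cvgP/cauchy_ballP => e e0.
have [k ke] : exists k, k.+1%:R^-1 < e.
  by have [k] := ltr_add_invr e0; rewrite add0r; exists k.
have [n /= nP] := H k.
have : \forall y \near within `[0, l]%classic x^',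
    [/\ y \in `[0, l], y != x & `|y - x| < n.+1%:R^-1].
  have : \forall y \near within `[0, l]%classic x^', `|x - y| < n.+1%:R^-1.
    apply: cvg_within; apply: cvg_within; rewrite /=.
    by apply: nbhsx_ballx; rewrite invr_gt0 ltr0n.
  apply: filterS3 (within_dnbhs_in _ x) (within_dnbhs_neq _ x).
  by move=> y yl yx; rewrite distrC.
move=> N.
set Q := fun y => [/\ y \in `[0, l], y != x & `|y - x| < n.+1%:R^-1] in N.
exists (quot f x @` Q, quot f x @` Q).
  by split; apply: filterS N => y Qy; exists y.
move=> [_ _] [/= [y [yl yx yd] <-] [z [zl zx zd] <-]].
rewrite /ball/=; apply: le_lt_trans ke; rewrite leNgt; apply/negP => ke.
by apply: nP; exists y, z.
Qed.

Lemma measurable_derivable_on l f : 0 < l -> {within `[0, l], continuous f} ->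
  measurable (`[0, l] `&` [set x | derivable_on `[0, l]%classic f x]).
Proof.
move=> l0 cf; rewrite [X in measurable X](_ : _ = `[0, l] `\`
   \bigcup_k \bigcap_n (`[0, l] `&` quotient_osc l f k.+1%:R^-1 n.+1%:R^-1)).
  apply: measurableD => //; apply: bigcupT_measurable => k.
  by apply: bigcapT_measurable => n; exact: measurable_quotient_osc.
apply/seteqP; split=> x /= [xl].
  move=> /(derivable_onE _ l0 xl) H; split=> // -[k _ kP].
  by have [n] := H k; apply; have [] := kP n I.
move=> H; split=> //; apply/(derivable_onE _ l0 xl) => k.
apply: contra_notP H => /forallNP kP; exists k => // n _; split=> //.
exact: contrapT (kP n).
Qed.

(** The segment splits into two Borel pieces: where the derivative exists it is a pointwise limit of
    measurable quotients, and elsewhere it is constant. *)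
Lemma measurable_derive_on l f : 0 < l -> {within `[0, l], continuous f} ->
  measurable_fun `[0, l] (derive_on `[0, l]%classic f).
Proof.
move=> l0 cf; set D := [set x | derivable_on `[0, l]%classic f x].
have mD := measurable_derivable_on l0 cf.
have mDC : measurable (`[0, l]%classic `\` D).
  rewrite -[X in measurable X]set0U -(setDv `[0, l]%classic) -setDIr.
  by apply: measurableD.
rewrite -[X in measurable_fun X _](setUIDK `[0, l]%classic D).
apply/measurable_funU => //; split; last first.
  (* Where the quotient has no limit, the set of its limits is empty, so [lim] returns the same
     default [get set0] at all these points. *)
  apply: (@eq_measurable_fun _ _ _ _ _ (cst (get (set0 : set R)))) => //.
  move=> x; rewrite inE/= => -[xl xD].
  rewrite /derive_on /lim /lim_in; congr get; apply/esym.
  rewrite -subset0 => a /= fa.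
  by apply: xD; rewrite /D/= /derivable_on; apply/cvg_ex; exists a.
(* A sequence tending to [x] without meeting it. It moves toward the farther end by at most [l / 2],
   hence stays in the segment. *)
pose s n x := if x <= l / 2 then x + l / 2 / n.+1%:R else x - l / 2 / n.+1%:R.
have hn n : 0 < l / 2 / n.+1%:R :> R by rewrite !divr_gt0// ltr0n.
have hnl n : l / 2 / n.+1%:R <= l / 2 :> R.
  by rewrite ler_pdivrMr ?ltr0n// ler_peMr ?ler1n// ltW// divr_gt0.
have sl n x : x \in `[0, l] -> s n x \in `[0, l].
  rewrite !in_itv/= /s => /andP[x0 xl].
  move: (l / 2 / n.+1%:R) (hn n) (hnl n) => h h0 hl.
  by case: (leP x (l / 2)) => *; lra.
have sx n x : s n x != x.
  rewrite /s -subr_eq0; case: ifPn => _;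
  by rewrite addrAC subrr add0r ?oppr_eq0 gt_eqF.
have ms n : measurable_fun `[0, l] (s n).
  apply: measurable_fun_if => //.
  - apply: measurable_fun_ler => //.
  - by apply: measurable_funD => //.
  - by apply: measurable_funB => //.
have mf : measurable_fun `[0, l] f.
  by apply: subspace_continuous_measurable_fun.
apply: (@measurable_fun_cvg _ _ _ _ (fun n x => quot f x (s n x))).
  move=> n; apply: (@measurable_funS _ _ _ _ `[0, l]) => //.
  pose c x := if x <= l / 2 then (l / 2 / n.+1%:R)^-1
              else - (l / 2 / n.+1%:R)^-1.
  rewrite (_ : (fun x => _) = (fun x => (f (s n x) - f x) * c x)); last first.
    apply/funext => x; rewrite /quot /s /c; case: ifPn => _.
      by rewrite addrAC subrr add0r.
    by rewrite [_ - _ - x]addrAC subrr add0r invrN.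
  apply: measurable_funM.
    apply: measurable_funB => //; apply: (measurable_comp _ _ mf) => //.
    by move=> _ [x xl <-]; exact: sl.
  by apply: measurable_fun_if => //; apply: measurable_fun_ler.
move=> x [xl dx].
have := derive_on_cvg dx; apply: cvg_comp => P.
rewrite /within /= /dnbhs /within /= => /nbhs_ballP[e /= e0 eP].
near=> n; apply: eP => //; last exact: sl.
rewrite /ball/= /s.
have -> : `|x - (if x <= l / 2 then x + l / 2 / n.+1%:R
                 else x - l / 2 / n.+1%:R)| = l / 2 / n.+1%:R.
  case: ifPn => _.
    by rewrite opprD addrA subrr sub0r normrN gtr0_norm.
  by rewrite opprB addrC subrK gtr0_norm.
rewrite ltr_pdivrMr ?ltr0n// -ltr_pdivrMl//.
near: n; exists (Num.trunc (e^-1 * (l / 2))).+1 => // n /= ln.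
apply: lt_le_trans (Num.Theory.truncnS_gt _) _; rewrite ler_nat.
by rewrite (leq_trans ln).
Unshelve. all: by end_near. Qed.

End measurable_derive_on.

(** * Square integrable functions *)

Section square_integrable.
Context d (T : measurableType d) (R : realType).
Variable mu : {measure set T -> \bar R}.
Implicit Types f g : T -> R.

Lemma Lfun2P f : f \in Lfun mu 2%:E <->
  measurable_fun setT f /\ mu.-integrable setT (EFin \o (fun x => f x ^+ 2)).
Proof.
split=> [f2|[mf /integrableP[_ foo]]].
  split; last exact: Lfun2_integrable_sqr.
  by move: f2; rewrite inE => /andP[/[!inE]].
rewrite inE; apply/andP; split; rewrite inE//= /finite_norm unlock /Lnorm.
rewrite poweR_lty//; apply: le_lt_trans foo; rewrite le_eqVlt; apply/orP; left.
apply/eqP/eq_integral => x _ /=.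
by rewrite powR_mulrn ?normr_ge0// normrX.
Qed.

(** Measurability of [f] is a separate hypothesis, since a.e. equality does not transfer it when the
    sigma-algebra is not complete. *)
Lemma ae_eq_Lfun2 f g : measurable_fun setT f -> g \in Lfun mu 2%:E ->
  f = g %[ae mu] -> f \in Lfun mu 2%:E.
Proof.
move=> mf /Lfun2P[mg /integrableP[mg2 goo]] fg; apply/Lfun2P; split=> //.
have mf2 : measurable_fun setT (EFin \o (fun x => f x ^+ 2)).
  by apply/measurable_EFinP; exact: measurable_funX.
apply/integrableP; split=> //.
rewrite (ae_eq_integral (fun x => abse (g x ^+ 2)%:E)) //.
- exact: measurableT_comp.
- exact: measurableT_comp.
- by apply: filterS fg => x /= H xT; rewrite (H xT).
Qed.

Lemma restrict_mul_integrable (D : set T) f g : measurable D ->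
  f \_ D \in Lfun mu 2%:E -> g \_ D \in Lfun mu 2%:E ->
  mu.-integrable D (fun x => (f x * g x)%:E).
Proof.
move=> mD f2 g2; apply/(integrable_mkcond _ mD).
have /Lfun1_integrable := Lfun2_mul_Lfun1 f2 g2.
apply: eq_integrable => // x _ /=; rewrite !patchE.
by case: ifPn; rewrite ?mul0r.
Qed.

End square_integrable.

(** * Absolute continuity: linear combinations and Lipschitz functions *)

Section absolutely_continuous.
Context (R : realType).
Implicit Types (a b c e : R) (f g : R -> R).

Lemma absolutely_continuous_on_linear a b f g c e :
  absolutely_continuous_on a b f -> absolutely_continuous_on a b g ->
  absolutely_continuous_on a b (fun x => c * f x + e * g x).
Proof.
move=> acf acg eps eps0.
(* Half of [eps] goes to each summand, divided by its coefficient; adding [1] keeps the divisor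
   positive for a zero coefficient. *)
have M0 (h : R) : 0 < eps / 2 / (`|h| + 1).
  by rewrite !divr_gt0// ltr_pwDr.
have [d1 d10 H1] := acf _ (M0 c); have [d2 d20 H2] := acg _ (M0 e).
exists (Num.min d1 d2); first by rewrite lt_min d10.
move=> k u v uv tuv; rewrite lt_min => /andP[s1 s2].
have {H1} := H1 _ _ _ uv tuv s1; have {H2} := H2 _ _ _ uv tuv s2.
set S2 := \sum_(i < k) _; set S1 := \sum_(i < k) _ => s2' s1'.
have bnd h S : 0 <= S -> S < eps / 2 / (`|h| + 1) -> `|h| * S < eps / 2.
  move=> S0 Sh; have h0 : 0 < `|h| + 1 by rewrite ltr_pwDr.
  rewrite (le_lt_trans (y := (`|h| + 1) * S))//.
    by rewrite ler_wpM2r// lerDl.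
  by rewrite mulrC -ltr_pdivlMr.
apply: (@le_lt_trans _ _ (`|c| * S1 + `|e| * S2)); last first.
  by rewrite [ltRHS]splitr ltrD// bnd// sumr_ge0.
rewrite !mulr_sumr -big_split/=; apply: ler_sum => i _.
rewrite -!normrM; apply: le_trans (ler_normD _ _).
by rewrite le_eqVlt; apply/orP; left; apply/eqP; congr `|_|; ring.
Qed.

Lemma lipschitz_absolutely_continuous_on a b f c :
  {in `[a, b] &, forall x y, `|f x - f y| <= c * `|x - y|} ->
  absolutely_continuous_on a b f.
Proof.
move=> lf eps eps0.
have c0 : 0 < `|c| + 1 by rewrite ltr_pwDr.
exists (eps / (`|c| + 1)); first by rewrite divr_gt0.
move=> k u v uv _; rewrite ltr_pdivlMr// mulrC; apply: le_lt_trans.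
rewrite mulr_sumr; apply: ler_sum => i _.
have [au uvi vb] := uv i.
apply: le_trans (lf _ _ _ _) _; rewrite ?in_itv/= ?vb ?au/= ?(le_trans au)//.
  by rewrite (le_trans uvi).
rewrite ger0_norm ?subr_ge0// ler_wpM2r ?subr_ge0//.
by rewrite (le_trans (ler_norm _))// lerDl.
Qed.

End absolutely_continuous.

(** * The function space is linear and its inner product bilinear *)

Section FF_space.
Context (R : realType) (G : metric_graph R) (p : nat).
Hypothesis p_ge1 : (1 <= p)%N.
Implicit Types (f g h : gpoint G -> R) (a b : R) (e : edge G) (v : vertex G).
Local Notation mu := (@lebesgue_measure R).

Lemma zero_in_edge_set e : 0 \in edge_set e.
Proof. by rewrite inE /edge_set/= in_itv/= lexx ltW// len_gt0. Qed.

Lemma edge_deriven_linear f g a b e i : Cm p.-1 f -> Cm p.-1 g ->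
  (i <= p.-1)%N -> {in edge_set e,
    edge_deriven i (fun x => a * f x + b * g x) e =1
    (fun x => a * edge_deriven i f e x + b * edge_deriven i g e x)}.
Proof.
move=> [cf _] [cg _] ip.
exact: (deriven_on_linear a b (len_gt0 e) (cf e).1 (cg e).1).
Qed.

(** The exit parametrization is either the edge parametrization or its reflection. *)
Lemma exit_nderivable f v e m :
  continuously_derivable_on (edge_set e) m (edge_fun f e) ->
  nderivable_on (edge_set e) m (fun t => f (exit_point v e t)).
Proof.
move=> [df _]; rewrite /exit_point; case: (v == src e) => //.
by have := nderivable_on_rev (len_gt0 e) df.
Qed.

Lemma exit_deriven_linear f g a b v e i : Cm p.-1 f -> Cm p.-1 g ->
  (i <= p.-1)%N -> exit_deriven i (fun x => a * f x + b * g x) v e =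
    a * exit_deriven i f v e + b * exit_deriven i g v e.
Proof.
move=> [cf _] [cg _] ip.
apply: (deriven_on_linear a b (len_gt0 e) (exit_nderivable (v := v) (cf e))
  (exit_nderivable (v := v) (cg e))) => //.
exact: zero_in_edge_set.
Qed.

Lemma Cm_linear f g a b : Cm p.-1 f -> Cm p.-1 g ->
  Cm p.-1 (fun x => a * f x + b * g x).
Proof.
move=> cf cg; split=> [e|v i ip].
  by apply: continuously_derivable_on_linear (len_gt0 e) (cf.1 e) (cg.1 e).
have := cf.2 v i ip; have := cg.2 v i ip; rewrite /kirchhoff; case: ifP => _.
  move=> kg kf; under eq_bigr do rewrite exit_deriven_linear//.
  by rewrite big_split/= -!mulr_sumr kf kg !mulr0 addr0.
move=> kg kf e e' ev ev'; rewrite !exit_deriven_linear//.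
by rewrite (kf e e')// (kg e e').
Qed.

Lemma edge_deriven_prE f e :
  edge_deriven p f e = derive_on (edge_set e) (edge_deriven p.-1 f e).
Proof. by rewrite /edge_deriven -[X in deriven_on _ X _ = _](prednK p_ge1). Qed.

(** At order [p] linearity holds only almost everywhere, because the derivative of order [p - 1] is
    differentiable only almost everywhere. *)
Lemma FF_linear_ae f g a b e : FF p f -> FF p g ->
  {ae mu, forall x, edge_set e x ->
    derivable_on (edge_set e) (edge_deriven p.-1 (fun x => a * f x + b * g x) e) x /\
    edge_deriven p (fun x => a * f x + b * g x) e x =
      a * edge_deriven p f e x + b * edge_deriven p g e x}.
Proof.
move=> [cf _ lf _] [cg _ lg _].
apply: (filterS2 (ae_filter_ringOfSetsType mu) _ (lf e).1 (lg e).1).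
move=> x df dg xe.
rewrite !edge_deriven_prE.
have E := edge_deriven_linear a b (e := e) cf cg (leqnn _).
have [d1 d2] := derive_on_linear a b (len_gt0 e) xe (df xe) (dg xe).
split; first exact/(eq_derivable_on xe E).
by rewrite (eq_derive_on E) ?inE.
Qed.

Lemma measurable_edge_deriven f e : Cm p.-1 f ->
  measurable_fun (edge_set e) (edge_deriven p f e).
Proof.
move=> [cf _]; rewrite edge_deriven_prE.
exact: measurable_derive_on (len_gt0 e) (cf e).2.
Qed.

Lemma FF_linear f g a b : FF p f -> FF p g -> FF p (fun x => a * f x + b * g x).
Proof.
move=> Ff Fg; have [cf af lf sf] := Ff; have [cg ag lg sg] := Fg.
have ch := Cm_linear a b cf cg.
split=> [//|e|e|].
(* Derivatives of the combination are known on the edge only; the points [u i] and [v i] lie on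
   it. *)
- move=> eps eps0.
  have [dlt dlt0 H] := absolutely_continuous_on_linear a b (af e) (ag e) eps0.
  exists dlt => // k u v uv tuv s; have := H k u v uv tuv s.
  congr (_ < _); apply: eq_bigr => i _; have [? ? ?] := uv i.
  have uA : u i \in edge_set e by rewrite inE /edge_set/= in_itv/=; lra.
  have vA : v i \in edge_set e by rewrite inE /edge_set/= in_itv/=; lra.
  by rewrite !(edge_deriven_linear a b cf cg).
- have ae := FF_linear_ae a b e Ff Fg.
  split.
    by apply: (@filterS _ _ (ae_filter_ringOfSetsType mu) _ _ _ ae) => x H /H[].
  have L2 : a *: (edge_deriven p f e \_ (edge_set e)) +
      b *: (edge_deriven p g e \_ (edge_set e)) \in Lfun mu 2%:E.
    have [z0 zl] := Lfun_submod_closed mu (lee1n 2).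
    rewrite -[X in _ + X]addr0; apply: (zl); first exact: (lf e).2.
    by apply: zl => //; exact: (lg e).2.
  (* The derivative of the combination equals this L2 function only a.e.; its measurability comes
     from [measurable_edge_deriven]. *)
  apply: ae_eq_Lfun2 L2 _.
    have mA : measurable (edge_set e) by exact: measurable_itv.
    by apply/(measurable_restrictT _ mA); exact: (measurable_edge_deriven (e := e) ch).
  apply: (@filterS _ _ (ae_filter_ringOfSetsType mu) _ _ _ ae) => x H _.
  rewrite !fctE !patchE.
  case: ifPn => [/set_mem/H[_ ->//]|_]; by rewrite !scaler0 addr0.
- by rewrite big_split/= -!mulr_sumr sf sg !mulr0 addr0.
Qed.

Lemma innerFC f g : innerF p f g = innerF p g f.
Proof.
apply: eq_bigr => e _; apply: eq_Rintegral => x _; exact: mulrC.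
Qed.

Lemma innerF_ge0 f : 0 <= innerF p f f.
Proof.
by apply: sumr_ge0 => e _; apply: Rintegral_ge0 => x _; rewrite -expr2 sqr_ge0.
Qed.

(** The integrands agree a.e. and are measurable, so the integrals agree. The right-hand side splits
    because products of L2 functions are integrable. *)
Lemma innerF_linearl f g h a b : FF p f -> FF p g -> FF p h ->
  innerF p (fun x => a * f x + b * g x) h = a * innerF p f h + b * innerF p g h.
Proof.
move=> Ff Fg Fh; rewrite /innerF !mulr_sumr -big_split/=; apply: eq_bigr => e _.
have [cf _ lf _] := Ff; have [cg _ lg _] := Fg; have [ch _ lh _] := Fh.
have mA : measurable (edge_set e) by exact: measurable_itv.
have ifh := restrict_mul_integrable (mu := mu) mA (lf e).2 (lh e).2.
have igh := restrict_mul_integrable (mu := mu) mA (lg e).2 (lh e).2.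
have mh := measurable_edge_deriven (e := e) ch.
rewrite -RintegralZl// -RintegralZl// -RintegralD//; last 2 first.
  exact: (integrableZl (mu := mu) mA a ifh).
  exact: (integrableZl (mu := mu) mA b igh).
congr fine; apply: ae_eq_integral => //.
- apply/measurable_EFinP; apply: measurable_funM => //.
  exact: measurable_edge_deriven (Cm_linear a b cf cg).
- apply/measurable_EFinP; apply: measurable_funD;
    (apply: measurable_funM => //; apply: measurable_funM => //;
     exact: measurable_edge_deriven).
apply: (@filterS _ _ (ae_filter_ringOfSetsType mu) _ _ _
  (FF_linear_ae a b e Ff Fg)) => x /= H xe.
rewrite (H xe).2.
by rewrite mulrDl !mulrA.
Qed.

End FF_space.

(** * Polynomials on a segment *)

Section polynomials.
Context (R : realType).
Implicit Types (l x : R) (f : R -> R) (q r : {poly R}).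

(** Factor [q - q(x) = s * ('X - x)]. Off [x] the difference quotient is [s], a continuous function,
    and [s(x) = q'(x)]. *)
Lemma derive_on_horner l q x : 0 < l -> x \in `[0, l] ->
  derivable_on `[0, l]%classic (horner q) x /\
  derive_on `[0, l]%classic (horner q) x = q^`().[x].
Proof.
move=> l0 xl; apply: cvg_derive_on => //.
have /factor_theorem[s qs] : root (q - q.[x]%:P) x.
  by rewrite rootE !hornerE subrr.
have -> : q^`().[x] = s.[x].
  have := congr1 (fun r => r^`().[x]) qs.
  by rewrite derivB derivM derivXsubC derivC subr0 !hornerE subrr mulr0 add0r.
have : s.[y] @[y --> within `[0, l]%classic x^'] --> s.[x].
  move=> P /(@continuous_horner R s x) sP.
  suff : \forall y \near within `[0, l]%classic x^', P s.[y] by [].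
  by apply: cvg_within; apply: cvg_within; rewrite /=.
apply: cvg_trans; apply: near_eq_cvg.
apply: filterS (within_dnbhs_neq `[0, l]%classic x) => y yx.
have := congr1 (horner^~ y) qs; rewrite !hornerE => ->.
by rewrite mulfK// subr_eq0.
Qed.

Lemma deriven_on_horner l f q i : 0 < l -> {in `[0, l]%classic, f =1 horner q} ->
  {in `[0, l]%classic, deriven_on `[0, l]%classic i f =1 horner q^`(i)}.
Proof.
move=> l0 fq; elim: i => [|i IH] x xl; first by rewrite derivn0; exact: fq.
have /= -> := eq_derive_on IH xl.
by move: xl; rewrite inE => /(derive_on_horner q^`(i) l0)[_ ->].
Qed.

Lemma nderivable_on_horner l f q m : 0 < l -> {in `[0, l]%classic, f =1 horner q} ->
  nderivable_on `[0, l] m f.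
Proof.
move=> l0 fq i x _ xl; apply/(eq_derivable_on xl (deriven_on_horner i l0 fq)).
by have [] := derive_on_horner q^`(i) l0 xl.
Qed.

Lemma horner_lipschitz l q : exists2 M : R, 0 <= M &
  {in `[0, l] &, forall x y, `|q.[x] - q.[y]| <= M * `|x - y|}.
Proof.
(* The induction on [q * 'X + c] also needs a bound on [q] itself. The new constant covers the bound
   [M * |l| + |c|] on values and the Lipschitz constant [M * |l| + M]. *)
suff [M M0 H] : exists2 M : R, 0 <= M & {in `[0, l] &, forall x y,
    `|q.[x]| <= M /\ `|q.[x] - q.[y]| <= M * `|x - y|}.
  by exists M => // x y xl yl; have [] := H x y xl yl.
elim/poly_ind: q => [|q c [M M0 IH]].
  by exists 0 => // x y _ _; rewrite !horner0 subrr normr0 mul0r.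
exists (M * `|l| + M + `|c|); first by rewrite !addr_ge0// mulr_ge0.
move=> x y xl yl; have [qx qxy] := IH x y xl yl.
have xL : `|x| <= `|l|.
  by move: xl; rewrite in_itv/= => /andP[x0 xl]; rewrite !ger0_norm ?(le_trans x0).
have yL : `|y| <= `|l|.
  by move: yl; rewrite in_itv/= => /andP[x0 xl']; rewrite !ger0_norm ?(le_trans x0).
rewrite !hornerE; split.
  rewrite (le_trans (ler_normD _ _))// lerD2r normrM ler_wpDr//.
  by rewrite ler_pM.
have -> : q.[x] * x + c - (q.[y] * y + c) =
    q.[x] * (x - y) + (q.[x] - q.[y]) * y by ring.
rewrite (le_trans (ler_normD _ _))// !normrM.
have h1 : `|q.[x]| * `|x - y| <= M * `|x - y| by rewrite ler_wpM2r.
have h2 : `|q.[x] - q.[y]| * `|y| <= M * `|x - y| * `|l| by rewrite ler_pM.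
have h3 : 0 <= `|c| * `|x - y| by rewrite mulr_ge0.
rewrite (le_trans (lerD h1 h2))// !mulrDl.
by rewrite -[leLHS]addr0 lerD// addrC mulrAC.
Qed.

(** Below degree [p] the only possibly nonzero coefficient of [q] is the constant one, [c]. *)
Lemma dvdXn_derivn (p i : nat) q c : 'X^p %| q - c%:P -> (i < p)%N ->
  q^`(i).[0] = if i == 0%N then c else 0.
Proof.
move=> /dvdpP[s qs] ip.
have -> : q = s * 'X^p + c%:P by rewrite -qs subrK.
rewrite horner_coef0 coef_derivn addn0 coefD coefMXn ip add0r coefC.
by case: i ip => [|i]; rewrite ?ffactnn ?fact0 ?mul0rn ?mulr1n.
Qed.

End polynomials.

(** * Piecewise polynomial functions in the space, and separation of points *)

Section splines.
Context (R : realType) (G : metric_graph R) (p : nat).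
Hypothesis p_ge1 : (1 <= p)%N.
Implicit Types (c : vertex G -> R) (q : edge G -> {poly R}).
Local Notation mu := (@lebesgue_measure R).

(** Vertex values are prescribed apart from the pieces, so this is defined on the glued space for
    any data; gluing is left to [flat_spline]. *)
Definition spline c q (x : gpoint G) : R :=
  match x with Vertex v => c v | Inner e y _ => (q e).[y] end.

(* The piece on [e] agrees with constants to order [p] at both end points, so
   that all exiting derivatives of order [1, ..., p - 1] vanish. *)
Definition flat_spline c q := forall e,
  'X^p %| q e - (c (src e))%:P /\
  'X^p %| q e \Po ((len e)%:P - 'X) - (c (tgt e))%:P.

(** [edge_point] matches on a proof that [Inner] then carries, so the case analysis is done by a
    dependent match. *)
Lemma edge_pointP (Q : gpoint G -> Prop) e x :
  (forall h : 0 < x < len e, Q (Inner e x h)) ->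
  (~ 0 < x < len e -> Q (Vertex (if x <= 0 then src e else tgt e))) ->
  Q (edge_point e x).
Proof.
move=> QI QV; rewrite /edge_point.
refine (match idP as r return Q (match r with
  ReflectT h => Inner e x h | ReflectF _ => _ end) with
  ReflectT h => QI h | ReflectF h => QV h end).
Qed.

(** At the two end points this is the order 0 part of flatness. *)
Lemma edge_fun_spline c q e : flat_spline c q ->
  {in edge_set e, edge_fun (spline c q) e =1 horner (q e)}.
Proof.
move=> /(_ e)[h0 h1] x; rewrite inE /edge_set/= in_itv/= => /andP[x0 xl].
rewrite /edge_fun;
apply: (edge_pointP (Q := fun z => spline c q z = (q e).[x])) => [//|].
have [x00|xn0] := eqVneq x 0 => /=.
  rewrite x00 lexx /=; have := dvdXn_derivn (i := 0) h0 p_ge1.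
  by rewrite derivn0 => ->.
move=> /negP; rewrite lt_neqAle eq_sym xn0 x0/= -leNgt => lx.
have -> : x = len e by apply/le_anti; rewrite xl.
rewrite leNgt len_gt0 /=; have := dvdXn_derivn (i := 0) h1 p_ge1.
by rewrite derivn0 horner_comp !hornerE subr0 => ->.
Qed.

Lemma exit_fun_spline c q v e : flat_spline c q -> e \in incident v ->
  exists2 r : {poly R}, 'X^p %| r - (c v)%:P &
   {in edge_set e, (fun t => spline c q (exit_point v e t)) =1 horner r}.
Proof.
move=> fs; rewrite inE /exit_point => ev.
have [h0 h1] := fs e; have E := edge_fun_spline (e := e) fs.
have [vs|vs] := eqVneq v (src e); first by exists (q e); rewrite ?vs.
exists (q e \Po ((len e)%:P - 'X)).
  by move: ev; rewrite (negPf vs) => /eqP ->.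
move=> t; rewrite inE /edge_set/= in_itv/= => tl.
rewrite horner_comp !hornerE -E// inE /edge_set/= in_itv/=; lra.
Qed.

(** At order 0 all exits from [v] give [c v]; at orders 1 to [p - 1] they all give 0, which settles
    both parities of the Kirchhoff conditions. Regularity is that of polynomials. *)
Lemma flat_spline_FF c q : flat_spline c q -> \sum_v c v = 0 -> FF p (spline c q).
Proof.
move=> fs c0.
have D e i := deriven_on_horner i (len_gt0 e) (edge_fun_spline (e := e) fs).
have mA (e : edge G) : measurable (edge_set e) by exact: measurable_itv.
have ex v e i : e \in incident v -> (i < p)%N ->
    exit_deriven i (spline c q) v e = if i == 0%N then c v else 0.
  move=> ev ip; have [r rc E] := exit_fun_spline fs ev.
  rewrite /exit_deriven (deriven_on_horner i (len_gt0 e) E) ?zero_in_edge_set//.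
  exact: dvdXn_derivn rc ip.
split=> [|e|e|//].
- split=> [e|v i ip].
    split.
      exact: nderivable_on_horner (len_gt0 e) (edge_fun_spline (e := e) fs).
    apply: (@subspace_eq_continuous _ (edge_set e) _ (horner (q e)^`(p.-1))).
      by move=> x xe; rewrite -(D e).
    by apply: continuous_subspaceT => x; exact: continuous_horner.
  have {}ip : (i < p)%N by rewrite -(prednK p_ge1) ltnS.
  rewrite /kirchhoff; case: ifPn => oi.
    rewrite big1// => e ev; rewrite ex//; by case: i oi {ip}.
  by move=> e e' ev ev'; rewrite !ex.
- have [M M0 H] := horner_lipschitz (len e) (q e)^`(p.-1).
  apply: (@lipschitz_absolutely_continuous_on _ _ _ _ M) => x y xl yl.
  by rewrite /edge_deriven !(D e) ?inE//; exact: H.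
- have nd := nderivable_on_horner (m := p) (len_gt0 e)
    (edge_fun_spline (e := e) fs).
  split; first by apply: aeW => x xe; apply: nd => //; rewrite ltn_predL.
  have -> : edge_deriven p (spline c q) e \_ (edge_set e) =
      (horner (q e)^`(p)) \_ (edge_set e).
    by apply/funext => x; rewrite !patchE; case: ifPn => // xe; rewrite -(D e).
  have mq r : measurable_fun (edge_set e) (horner r : R -> R).
    apply: measurable_funTS; apply: continuous_measurable_fun.
    exact: continuous_horner.
  apply/Lfun2P; split; first by apply/(measurable_restrictT _ (mA e)).
  have : mu.-integrable (edge_set e) (EFin \o horner ((q e)^`(p) ^+ 2)).
    apply: continuous_compact_integrable; first exact: segment_compact.
    by apply: continuous_subspaceT => x; exact: continuous_horner.
  move=> /(integrable_mkcond (mu := mu) _ (mA e)); apply: eq_integrable => // x _.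
  by rewrite /= !patchE; case: ifPn => _ /=; rewrite ?horner_exp ?expr0n.
Qed.

(** The factor of exponent [p] vanishes to order [p] at both ends of [e], so [r] is free. *)
Lemma interior_bump_FF e (r : {poly R}) :
  FF p (spline (fun=> 0) (fun e' =>
    if e' == e then r * ('X * ('X - (len e)%:P)) ^+ p else 0)).
Proof.
apply: flat_spline_FF; last by rewrite big1.
move=> e'; case: ifPn => [/eqP ->|_]; last by rewrite comp_poly0 !subr0 !dvdp0.
rewrite !subr0; split.
  by rewrite exprMn mulrA mulrAC dvdp_mull.
rewrite rmorphM/= rmorphXn/= comp_polyM comp_polyB comp_polyC comp_polyX.
by rewrite exprMn dvdp_mull// dvdp_mull// addrAC subrr add0r exprNn dvdp_mull.
Qed.

(* Bezout for the coprime polynomials 'X^p and ('X - l)^p. *)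
Lemma flat_transition (l : R) : l != 0 ->
  exists r : {poly R}, 'X^p %| r /\ 'X^p %| r \Po (l%:P - 'X) - 1.
Proof.
move=> l0.
have cop : coprimep ('X^p : {poly R}) (('X - l%:P) ^+ p).
  by rewrite coprimep_expl// coprimep_expr// coprimep_XsubC rootE hornerX.
have [[u v] /= uv] := Bezout_eq1_coprimepP _ _ cop.
exists (u * 'X^p); rewrite dvdp_mull//; split=> //.
have -> : u * 'X^p = 1 - v * ('X - l%:P) ^+ p by rewrite -uv addrK.
rewrite rmorphB rmorph1 rmorphM rmorphXn/= comp_polyB comp_polyX comp_polyC.
rewrite addrAC subrr add0r addrAC subrr add0r.
by rewrite exprNn dvdpNr dvdp_mull// dvdp_mull.
Qed.

Lemma vertex_spline_FF c : \sum_v c v = 0 ->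
  exists2 f, FF p f & forall v, f (Vertex v) = c v.
Proof.
move=> c0.
have /boolp.choice[r rP] :=
  fun e : edge G => flat_transition (lt0r_neq0 (len_gt0 e)).
(* The transition [r e] is flat with value 0 at the source and 1 at the target, so [q e] passes
   flatly from one vertex value to the other. *)
pose q e : {poly R} := (c (src e))%:P + (c (tgt e) - c (src e))%:P * r e.
exists (spline c q) => //; apply: flat_spline_FF c0 => e; have [r0 rl] := rP e.
split; first by rewrite /q addrAC subrr add0r dvdp_mull.
rewrite comp_polyD comp_polyM !comp_polyC.
have -> : (c (src e))%:P + (c (tgt e) - c (src e))%:P * (r e \Po ((len e)%:P - 'X))
    - (c (tgt e))%:P =
    (c (tgt e) - c (src e))%:P * (r e \Po ((len e)%:P - 'X) - 1).
  by rewrite !polyCB; ring.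
exact: dvdp_mull.
Qed.

(** Two vertices are separated by interpolating vertex values; if a point is interior to an edge, a
    bump on that edge is nonzero there and can be made to vanish at the other point. *)
Lemma FF_separates (x1 x2 : gpoint G) : x1 <> x2 ->
  exists2 f, FF p f & f x1 <> f x2.
Proof.
(* By symmetry, [x1] is interior unless both points are vertices. *)
wlog : x1 x2 / if x1 is Vertex _ then if x2 is Vertex _ then True else False
               else True.
  move=> W; case: x1 x2 => [v1|e1 y1 h1] [v2|e2 y2 h2] x12.
  - by apply: W.
  - have [|f Ff ne] := W (Inner e2 y2 h2) (Vertex v1) I.
      by move=> E; apply: x12.
    by exists f => // E; apply: ne.
  - exact: W.
  - exact: W.
case: x1 => [v1|e y h] + x12.
  case: x2 x12 => [v2|//] x12 _.
  pose n : R := #|vertex G|%:R.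
  have n0 : n != 0.
    by rewrite pnatr_eq0 -lt0n; apply/card_gt0P; exists v1.
  (* The indicator of [v1], shifted by [1 / n] so that the vertex values sum to 0. *)
  have [|f Ff fE] := @vertex_spline_FF (fun v => (v == v1)%:R - n^-1).
    rewrite sumrB sumr_const -[n^-1 *+ _]mulr_natr mulVf//.
    by rewrite (bigD1 v1)//= eqxx big1 ?addr0 ?subrr// => v /negPf ->.
  exists f => //; rewrite !fE eqxx => /addIr.
  have -> : (v2 == v1) = false by apply/eqP => E; apply: x12; rewrite E.
  by apply/eqP; rewrite oner_eq0.
move=> _.
pose b (r : {poly R}) := spline (fun=> 0) (fun e' =>
    if e' == e then r * ('X * ('X - (len e)%:P)) ^+ p else 0).
have bn : ('X * ('X - (len e)%:P)).[y] != 0 :> R.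
  have /andP[y0 yl] := h.
  rewrite hornerM hornerX hornerXsubC.
  by rewrite mulf_neq0 ?subr_eq0 ?(gt_eqF y0) ?(lt_eqF yl).
have by0 (r : {poly R}) : r.[y] != 0 -> (b r) (Inner e y h) != 0.
  by move=> r0; rewrite /b/= eqxx hornerM horner_exp mulf_neq0// expf_neq0.
(* The bump already vanishes at [x2] unless [x2] is interior to the same edge; in that case the
   factor ['X - y2] is inserted. *)
have [z z0 zy] : exists2 z, b z x2 = 0 & z.[y] != 0.
  case: x2 x12 => [v2|e2 y2 h2] x12.
    by exists 1 => //; rewrite hornerC oner_eq0.
  have [ee|ee] := eqVneq e2 e; last first.
    by exists 1; rewrite /b/= ?(negPf ee) ?horner0// hornerC oner_eq0.
  subst e2; exists ('X - y2%:P).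
    by rewrite /b/= eqxx hornerM hornerXsubC subrr mul0r.
  rewrite hornerXsubC subr_eq0; apply/eqP => yy; subst y2; apply: x12.
  (* Inner points with the same parameter are equal because the proofs they carry are. *)
  by congr Inner; exact: bool_irrelevance.
exists (b z); first exact: interior_bump_FF.
by rewrite z0; apply/eqP/by0.
Qed.

End splines.

(** * Extremal problems for increments in an abstract reproducing kernel space *)

Section rkhs.
Context (R : realType) (T : Type) (F : set (T -> R)).
Variables (inner : (T -> R) -> (T -> R) -> R) (K : T -> T -> R).
Hypothesis F_linear : forall (a b : R) f g, F f -> F g ->
  F (fun x => a * f x + b * g x).
Hypothesis innerC : forall f g, inner f g = inner g f.
Hypothesis inner_ge0 : forall f, 0 <= inner f f.
Hypothesis inner_linearl : forall (a b : R) f g h, F f -> F g -> F h ->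
  inner (fun x => a * f x + b * g x) h = a * inner f h + b * inner g h.
Hypothesis K_rkhs : reproducing_kernel F inner K.
Implicit Types (f g : T -> R) (x y : T) (a : R).

Lemma inner_linearr a b f g h : F f -> F g -> F h ->
  inner h (fun x => a * f x + b * g x) = a * inner h f + b * inner h g.
Proof. by move=> *; rewrite innerC inner_linearl// !(innerC _ h). Qed.

(** Only semidefiniteness is assumed, so the case of a [g] of norm 0 is treated apart. *)
Lemma inner_CauchySchwarz f g : F f -> F g ->
  inner f g ^+ 2 <= inner f f * inner g g.
Proof.
move=> Ff Fg.
have H t : 0 <= inner f f - 2 * t * inner f g + t ^+ 2 * inner g g.
  have := inner_ge0 (fun x => 1 * f x + - t * g x).
  rewrite inner_linearl ?inner_linearr//; last exact: F_linear.
  by rewrite (innerC g f); congr (0 <= _); ring.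
have := inner_ge0 g; rewrite le_eqVlt => /predU1P[g0|g0].
  rewrite -g0 mulr0; have [->|fg0] := eqVneq (inner f g) 0.
    by rewrite expr0n.
  (* For this [t] the affine expression in [H] equals [-1]. *)
  have := H ((inner f f + 1) / 2 / inner f g).
  rewrite -g0 mulr0 addr0.
  rewrite (_ : 2 * _ * _ = inner f f + 1); last by field.
  by rewrite opprD addrA subrr add0r oppr_ge0 ler10.
(* This [t] minimizes the quadratic. *)
rewrite -ler_pdivrMr//; have := H (inner f g / inner g g).
rewrite (_ : _ + _ = inner f f - inner f g ^+ 2 / inner g g); last first.
  by field; rewrite gt_eqF.
by rewrite subr_ge0.
Qed.

Lemma kernelC x y : K x y = K y x.
Proof.
by rewrite (K_rkhs.2 (K^~ y))// ?(K_rkhs.2 (K^~ x) y) 1?innerC//; exact: K_rkhs.1.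
Qed.

Let gam x y := K x x + K y y - 2 * K x y.
(** Written with coefficients [1] and [-1] to match the linear combinations of the hypotheses. *)
Let ker x y := fun z => 1 * K z x + -1 * K z y.

Lemma ker_in x y : F (ker x y).
Proof. by apply: F_linear; exact: K_rkhs.1. Qed.

Lemma inner_ker f x y : F f -> inner f (ker x y) = f x - f y.
Proof.
move=> Ff; rewrite inner_linearr//; [|exact: K_rkhs.1..].
by rewrite -!K_rkhs.2// mul1r mulN1r.
Qed.

Lemma inner_ker_ker x y : inner (ker x y) (ker x y) = gam x y.
Proof.
rewrite inner_ker; last exact: ker_in.
by rewrite /ker /gam (kernelC y x); ring.
Qed.

Lemma sqr_increment_le f x y : F f ->
  (f x - f y) ^+ 2 <= inner f f * gam x y.
Proof.
move=> Ff; rewrite -(inner_ker _ _ Ff) -inner_ker_ker.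
exact: inner_CauchySchwarz (ker_in _ _).
Qed.

(** If [gam x y] were 0, Cauchy-Schwarz would make every increment between [x] and [y] vanish. *)
Lemma gam_gt0 f x y : F f -> f x <> f y -> 0 < gam x y.
Proof.
move=> Ff fxy; rewrite lt_neqAle -{2}inner_ker_ker inner_ge0 andbT.
apply/eqP => g0; apply: fxy; apply/eqP; rewrite -subr_eq0 -sqrf_eq0.
by rewrite eq_le sqr_ge0 (le_trans (sqr_increment_le x y Ff))// -g0 mulr0.
Qed.

(** The multiples of [ker x y] give equality in Cauchy-Schwarz: the maximum is attained with
    [a = gam^(-1/2)], the minimum with [a = gam^(-1)]. *)
Lemma increment_extremal a x y :
  F (fun z => a * ker x y z + 0 * ker x y z) /\
  (inner (fun z => a * ker x y z + 0 * ker x y z)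
         (fun z => a * ker x y z + 0 * ker x y z) = a ^+ 2 * gam x y /\
   (a * ker x y x + 0 * ker x y x) - (a * ker x y y + 0 * ker x y y) =
     a * gam x y).
Proof.
have Fk := ker_in x y; have Fa := F_linear a 0 Fk Fk; split=> //.
split.
  rewrite (inner_linearl a 0 Fk Fk Fa) (inner_linearr a 0 Fk Fk Fk).
  by rewrite !inner_ker_ker; ring.
by rewrite -(inner_ker_ker x y) (inner_ker _ _ Fk); ring.
Qed.

(** For [x = y] the maximum is 0 and [f0], once normalized, shows that the unit sphere is nonempty;
    for [x <> y] the normalized [ker x y] attains the bound. *)
Lemma increment_max f0 x y : F f0 -> inner f0 f0 != 0 ->
  (x <> y -> exists2 f, F f & f x <> f y) ->
  is_max [set (f x - f y) ^+ 2 | f in [set f | F f /\ Num.sqrt (inner f f) = 1]]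
         (gam x y).
Proof.
move=> Ff0 f00 sep; split; last first.
  move=> _ [f [Ff f1] <-].
  have := sqr_increment_le x y Ff.
  by rewrite -(sqr_sqrtr (inner_ge0 f)) f1 expr1n mul1r.
have [xy|/sep[f Ff fxy]] := pselect (x = y).
  have n0 : 0 < inner f0 f0 by rewrite lt_neqAle eq_sym f00 inner_ge0.
  exists (fun z => (Num.sqrt (inner f0 f0))^-1 * f0 z + 0 * f0 z).
    split; first exact: F_linear.
    rewrite inner_linearl ?inner_linearr//; last exact: F_linear.
    by rewrite !mul0r !addr0 mulrA -expr2 exprVn sqr_sqrtr// mulVf// sqrtr1.
  by rewrite xy subrr expr0n/= /gam; ring.
have g0 := gam_gt0 Ff fxy.
have [Fk [nk vk]] := increment_extremal (Num.sqrt (gam x y))^-1 x y.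
eexists.
  split; first exact: Fk.
  by rewrite nk exprVn sqr_sqrtr ?ltW// mulVf ?gt_eqF// sqrtr1.
by rewrite /= vk exprMn exprVn sqr_sqrtr ?ltW// expr2 mulrA mulVf ?gt_eqF// mul1r.
Qed.

Lemma energy_min x y f : F f -> f x <> f y ->
  is_min [set Num.sqrt (inner f f) ^+ 2 |
            f in [set f | F f /\ `|f x - f y| = 1]] (gam x y)^-1.
Proof.
move=> Ff fxy; have g0 := gam_gt0 Ff fxy; split; last first.
  move=> _ [h [Fh h1] <-]; rewrite sqr_sqrtr// -[leLHS]mul1r ler_pdivrMr//.
  have := sqr_increment_le x y Fh.
  by rewrite -real_normK ?num_real// h1 expr1n.
have [Fk [nk vk]] := increment_extremal (gam x y)^-1 x y.
eexists; first by split; [exact: Fk|rewrite vk mulVf ?gt_eqF// normr1].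
rewrite sqr_sqrtr// nk; field; exact: lt0r_neq0.
Qed.

End rkhs.

(** * Variogram and covariance of a centered process *)

Section variogram.
Context (R : realType) (d : measure_display) (Omega : measurableType d).
Variables (P : probability Omega R) (T : Type) (Z : T -> {RV P >-> R}).
Hypothesis Z_centered : centered Z.
Hypothesis Z_fin : forall x y, covariance P (Z x) (Z y) \is a fin_num.

(** With mean 0, the covariance of [Z x] with itself is its second moment, and it is finite. *)
Lemma centered_Lfun2 x : (Z x : Omega -> R) \in Lfun P 2%:E.
Proof.
apply/Lfun2P; split; first exact: measurable_funP.
have mZ2 : measurable_fun setT (EFin \o (fun w => Z x w ^+ 2)).
  by apply/measurable_EFinP; apply: measurable_funX; exact: measurable_funP.
apply/integrableP; split=> //.
have := Z_fin x x; rewrite covariance.unlock Z_centered/= unlock.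
rewrite ge0_fin_numE; last first.
  by apply: integral_ge0 => w _; rewrite lee_fin -expr2 sqr_ge0.
apply: le_lt_trans; rewrite le_eqVlt; apply/orP; left; apply/eqP.
apply: eq_integral => w _ /=.
by rewrite ger0_norm ?sqr_ge0// !fctE/= subr0 expr2.
Qed.

Lemma variogramE x y : variogram Z x y =
  covfun Z x x + covfun Z y y - 2 * covfun Z x y.
Proof.
rewrite /variogram varianceB ?centered_Lfun2// /variance /covfun.
by rewrite fineB ?fineD ?fineM// ?fin_numD ?fin_numM ?Z_fin.
Qed.

Lemma covfunC x y : covfun Z x y = covfun Z y x.
Proof. by rewrite /covfun covarianceC. Qed.

End variogram.

Theorem proposition3p5 (R : realType) (G : metric_graph R) (p : nat)
    (p_ge1 : (1 <= p)%N)
    (d : measure_display) (Omega : measurableType d) (P : probability Omega R)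
    (Z : gpoint G -> {RV P >-> R})
    (Z_gaussian : gaussian_process Z) (Z_centered : centered Z)
    (Z_rkhs : has_rkhs Z (FF p) (innerF p)) :
  let gamma := variogram Z in
  let n : R := #|vertex G|%:R in
  let c : R :=
    - (1 / (2 * n ^+ 2)) *
      \sum_(v : vertex G) \sum_(w : vertex G) gamma (Vertex v) (Vertex w) in
  [/\ (0 < #|edge G|)%N -> forall x1 x2 : gpoint G,
        is_max [set (f x1 - f x2) ^+ 2 | f in [set f | FF p f /\ normF p f = 1]]
          (gamma x1 x2),
      forall x1 x2 : gpoint G, x1 <> x2 ->
        exists2 a : R,
          is_min [set normF p f ^+ 2 |
                    f in [set f | FF p f /\ `|f x1 - f x2| = 1]] a
          & gamma x1 x2 = a^-1
    & forall x1 x2 : gpoint G,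
        covfun Z x1 x2 =
          c + 1 / (2 * n) *
            \sum_(v : vertex G)
              (gamma (Vertex v) x1 + gamma (Vertex v) x2 - gamma x1 x2)].
Proof.
move=> gamma n c; have [Zfin Zk] := Z_rkhs.
have gammaE x y : gamma x y =
    covfun Z x x + covfun Z y y - 2 * covfun Z x y by exact: variogramE.
have lin (a b : R) (f g : gpoint G -> R) : FF p f -> FF p g ->
    FF p (fun x => a * f x + b * g x).
  exact: FF_linear.
have inl (a b : R) (f g h : gpoint G -> R) : FF p f -> FF p g -> FF p h ->
    innerF p (fun x => a * f x + b * g x) h = a * innerF p f h + b * innerF p g h.
  exact: innerF_linearl.
have sep (x y : gpoint G) := @FF_separates R G p p_ge1 x y.
split.
(* An edge has two distinct end points; a function separating them has nonzero norm, by
   Cauchy-Schwarz for their increment. *)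
- move=> /card_gt0P[e _] x1 x2.
  have [|f Ff fe] := sep (Vertex (src e)) (Vertex (tgt e)).
    by case=> E; have := no_loop e; rewrite E eqxx.
  rewrite gammaE.
  have := increment_max lin (@innerFC R G p) (@innerF_ge0 R G p) inl Zk
    (x := x1) (y := x2) Ff.
  apply; last exact: sep.
    apply/eqP => f0; apply: fe; apply/eqP; rewrite -subr_eq0 -sqrf_eq0.
    have := sqr_increment_le lin (@innerFC R G p) (@innerF_ge0 R G p) inl Zk
      (Vertex (src e)) (Vertex (tgt e)) Ff.
    by rewrite f0 mul0r => H; rewrite eq_le H sqr_ge0.
- move=> x1 x2 /sep[f Ff fx]; exists (gamma x1 x2)^-1; last by rewrite invrK.
  rewrite gammaE.
  exact: (energy_min lin (@innerFC R G p) (@innerF_ge0 R G p) inl Zk Ff fx).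
- move=> x1 x2.
  have n0 : n != 0.
    rewrite pnatr_eq0 -lt0n; apply/card_gt0P.
    by case: x1 => [v|e _ _]; [exists v|exists (src e)].
  (* The kernel section at [x] belongs to the space, whose members have vertex sum 0. *)
  have K0 x : \sum_v covfun Z (Vertex v) x = 0 by have [_ _ _] := Zk.1 x.
  pose D := \sum_v covfun Z (Vertex v) (Vertex v).
  have gs x : \sum_v gamma (Vertex v) x = D + n * covfun Z x x.
    under eq_bigr do rewrite gammaE.
    rewrite sumrB -mulr_sumr K0 mulr0 subr0 big_split/= sumr_const.
    by rewrite -[covfun Z x x *+ _]mulr_natl.
  (* Summing [gs] over the vertices gives [n * D + n * D], and the factor in [c] turns this into
     [- D / n]. It cancels the [D / n] left by the two sums in the formula. *)
  have -> : c = - (D / n).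
    have gC x y : gamma x y = gamma y x.
      by rewrite !gammaE (covfunC Z y x); ring.
    rewrite /c; under eq_bigr do (under eq_bigr do rewrite gC; rewrite gs).
    by rewrite big_split/= sumr_const -mulr_sumr -/D -mulr_natl -/n; field.
  rewrite sumrB big_split/= !gs sumr_const -[gamma x1 x2 *+ _]mulr_natl -/n gammaE.
  by field.
Qed.
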